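(* The following two statements are equivalent. (A) For every positive integer $n$ and every system $T\subseteq\{x_i+1=x_k,\ x_i\cdot x_j=x_k:\ i,j,k\in\{1,\ldots,n\}\}$ which has only finitely many solutions in positive integers $x_1,\ldots,x_n$, each such solution satisfies $x_1,\ldots,x_n\leqslant f(n)$. (B) For every positive integer $n$ and all positive integers $x_1,\ldots,x_n$ with $\max(x_1,\ldots,x_n)>f(n)$, there exist positive integers $y_1,\ldots,y_n$ such that $\max(x_1,\ldots,x_n)<\max(y_1,\ldots,y_n)$; for all $i,k\in\{1,\ldots,n\}$, $x_i+1=x_k$ implies $y_i+1=y_k$; and for all $i,j,k\in\{1,\ldots,n\}$, $x_i\cdot x_j=x_k$ implies $y_i\cdot y_j=y_k$.
   Context: Define $f:\mathbb{N}\setminus\{0\}\to\mathbb{N}\setminus\{0\}$ by $f(1)=1$, $f(n)=2^{2^{n-2}}$ for $n\in\{2,3,4,5\}$, and $f(n)=\left(2+2^{2^{n-4}}\right)^{2^{n-4}}$ for $n\geqslant 6$. *)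

(* Defs.v *)
From mathcomp Require Export all_boot.
From mathcomp Require Export classical_sets cardinality.

Set Implicit Arguments.
Unset Strict Implicit.
Unset Printing Implicit Defensive.

(* Only the values at n >= 1 are meaningful; f 0 = 1 is a junk value. *)
Definition f (n : nat) : nat :=
  if n <= 1 then 1
  else if n <= 5 then 2 ^ (2 ^ (n - 2))
  else (2 + 2 ^ (2 ^ (n - 4))) ^ (2 ^ (n - 4)).

(* Formal equations in the unknowns x_1, ..., x_n, indexed here by 'I_n:
   [SuccEq i k] is x_i + 1 = x_k and [MulEq i j k] is x_i * x_j = x_k
   (the indices need not be distinct). *)
Inductive equation (n : nat) : Type :=
  | SuccEq of 'I_n & 'I_n
  | MulEq of 'I_n & 'I_n & 'I_n.

Definition satisfies (n : nat) (x : {ffun 'I_n -> nat}) (e : equation n) : Prop :=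
  match e with
  | SuccEq i k => x i + 1 = x k
  | MulEq i j k => x i * x j = x k
  end.

Definition positive_solutions (n : nat) (T : set (equation n)) :
    set {ffun 'I_n -> nat} :=
  fun x => (forall i, 0 < x i) /\ (forall e, T e -> satisfies x e).

(* Main.v *)
Require Import Defs.
From mathcomp Require Import boolp.

Local Open Scope classical_set_scope.

(** Finiteness of a set of tuples of naturals amounts to a bound on their maxima
    ([finite_bounded_ffun], [finite_set_bounded]). If (B) fails at [x], the system of all equations
    true of [x] has no solution with a larger maximum, hence finitely many solutions, against (A).
    Conversely, (B) turns a solution above [f n] into one of the same system with a larger maximum;
    iterating yields unbounded maxima. *)

Lemma finite_bounded_ffun (n M : nat) (A : set {ffun 'I_n -> nat}) :
  (forall y, A y -> \max_(i < n) y i <= M) -> finite_set A.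
Proof.
move=> AM.
(* Tuples bounded by [M] lie in the image under [g] of a finite type. *)
pose g (z : {ffun 'I_n -> 'I_M.+1}) : {ffun 'I_n -> nat} := [ffun i => val (z i)].
apply: (@sub_finite_set _ _ (g @` setT)); last exact/finite_image/finite_finset.
move=> y /AM yM; exists [ffun i => inord (y i)] => //.
apply/ffunP => i; rewrite !ffunE /= inordK // ltnS.
exact: leq_trans (leq_bigmax i) yM.
Qed.

Lemma finite_set_bounded (T : choiceType) (h : T -> nat) (A : set T) :
  finite_set A -> exists M, forall y, A y -> h y <= M.
Proof.
case/finite_seqP => s ->; exists (\max_(y <- s) h y) => y ys.
exact: leq_bigmax_seq.
Qed.

Theorem theorem7 :
  (forall n : nat, 0 < n ->
   forall T : set (equation n),
     finite_set (positive_solutions T) ->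
     forall x : {ffun 'I_n -> nat}, positive_solutions T x ->
     forall i : 'I_n, x i <= f n)
  <->
  (forall n : nat, 0 < n ->
   forall x : {ffun 'I_n -> nat}, (forall i : 'I_n, 0 < x i) ->
     f n < \max_(i < n) x i ->
     exists y : {ffun 'I_n -> nat},
       [/\ (forall i : 'I_n, 0 < y i),
           \max_(i < n) x i < \max_(i < n) y i,
           (forall i k : 'I_n, x i + 1 = x k -> y i + 1 = y k)
         & (forall i j k : 'I_n, x i * x j = x k -> y i * y j = y k)]).
Proof.
split=> [hA n n_gt0 x x_gt0 fx | hB n n_gt0 T finT x xT i].
- apply: contrapT => noy.
  (* The largest system solved by [x]: its positive solutions are the positive [y] that preserve
     every relation of [x]. *)
  pose T : set (equation n) := [set e | satisfies x e].
  suff finT : finite_set (positive_solutions T).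
    have : \max_(i < n) x i <= f n.
      by apply/bigmax_leqP => i _; apply: (hA n n_gt0 T finT x).
    by rewrite leqNgt fx.
  apply: (@finite_bounded_ffun _ (\max_(i < n) x i)) => y [y_gt0 yT].
  rewrite leqNgt; apply/negP => xy; apply: noy; exists y; split=> //.
  + by move=> i k; exact: (yT (SuccEq i k)).
  + by move=> i j k; exact: (yT (MulEq i j k)).
- rewrite leqNgt; apply/negP => fxi.
  have [M solM] :=
    finite_set_bounded _ (fun y : {ffun 'I_n -> nat} => \max_(i < n) y i) _ finT.
  (* Including [f n] in the lower bound keeps (B) applicable to each new solution; [m := M] then
     contradicts finiteness. *)
  have unbounded m : exists y, positive_solutions T y /\ f n + m < \max_(i < n) y i.
    elim: m => [|m [y [[y_gt0 yT] my]]].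
      by exists x; split=> //; rewrite addn0; exact: leq_trans fxi (leq_bigmax i).
    have [|z [z_gt0 yz zS zM]] := hB n n_gt0 y y_gt0.
      exact: leq_ltn_trans (leq_addr _ _) my.
    exists z; split; last by rewrite addnS; exact: leq_ltn_trans my yz.
    by split=> // -[i' k|i' j k] /yT; [exact: zS | exact: zM].
  have [y [/solM yM]] := unbounded M.
  by rewrite ltnNge (leq_trans yM (leq_addl _ _)).
Qed.
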